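(* Let $k$ and $i$ be fixed positive integers with $1\leq i\leq k+1$. Then for every positive integer $n$, \[ \overline{\eta}_{2k}(n)=\sum_{m=1}^{\infty}\binom{m+k-1}{2k}N(m,n) \] is equal to the number of $(k+1)$-marked Durfee symbols $\tau$ of $n$ whose $i$-th rank $\rho_i(\tau)$ is positive.
   Context: A partition $\lambda=(\lambda_1,\ldots,\lambda_s)$ has parts $\lambda_1\ge\cdots\ge\lambda_s\ge1$; $\ell(\lambda)=s$ is its number of parts and $|\lambda|$ its sum. The rank of a partition is its largest part minus its number of parts, and $N(m,n)$ denotes the number of partitions of $n$ with rank $m$. For a positive integer $k$, a $k$-marked Durfee symbol of $n$ is an array $\tau=\begin{pmatrix}\alpha^k,&\alpha^{k-1},&\ldots,&\alpha^1\\ \beta^k,&\beta^{k-1},&\ldots,&\beta^1\end{pmatrix}_D$ consisting of $k$ pairs $(\alpha^j,\beta^j)$ of partitions and a positive integer $D$ such that: (1) $\alpha^j$ is nonempty for $1\le j<k$, while $\alpha^k$ and all $\beta^j$ may be empty; (2) for $2\le j\le k$, $\beta^{j-1}_1\le\alpha^{j-1}_1\le\min\{\alpha^j_s,\beta^j_s\}$, where $\alpha^j_s,\beta^j_s$ denote the smallest parts of $\alpha^j,\beta^j$ (the minimum taken over those that are nonempty), and $\beta^{j-1}_1$ is the largest part of $\beta^{j-1}$ (condition vacuous if empty); (3) the largest parts $\alpha^k_1,\beta^k_1$ are at most $D$; (4) $\sum_{j=1}^k(|\alpha^j|+|\beta^j|)+D^2=n$. The $j$-th rank of $\tau$ is $\rho_j(\tau)=\ell(\alpha^j)-\ell(\beta^j)-1$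 for $1\le j<k$ and $\rho_k(\tau)=\ell(\alpha^k)-\ell(\beta^k)$.
   Formalization: All parts of every α^j, β^j are required to be at most D, not only those of the top column; without this, when the top pair is empty the parts below are unbounded and the claim fails (k=i=1, n=4: D=1, α^1=(2,1) gives 4 symbols instead of 3). *)

(* Defs.v *)
From HB Require Import structures.
From mathcomp Require Import all_boot all_order all_algebra.
From mathcomp Require Import finmap.
From mathcomp Require Import boolp classical_sets functions cardinality fsbigop.

Set Implicit Arguments.
Unset Strict Implicit.
Unset Printing Implicit Defensive.

Import Order.TTheory GRing.Theory Num.Theory.

Local Open Scope classical_set_scope.

(* [fset_set] is a junk value on infinite sets; every set counted below is
   finite, by [finite_partitions] and [finite_marked_durfee]. *)
Definition count_set (T : choiceType) (A : set T) : nat := #|` fset_set A|.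

Definition is_partition (s : seq nat) : bool := sorted geq s && (0 \notin s).

(* Partitions are listed in non-increasing order.  The value 0 of [largest_part]
   on the empty partition makes upper bounds on its largest part vacuous, while
   [smallest_part] is only used under a non-emptiness guard. *)
Definition largest_part (s : seq nat) : nat := head 0 s.
Definition smallest_part (s : seq nat) : nat := last 0 s.

Definition partition_rank (s : seq nat) : int :=
  ((largest_part s)%:Z - (size s)%:Z)%R.

Definition partitions_of (n : nat) : set (seq nat) :=
  [set s | is_partition s /\ sumn s = n].

Definition rank_count (m : int) (n : nat) : nat :=
  count_set [set s | partitions_of n s /\ partition_rank s = m].

(* The support of the summand is finite, by [finite_eta_bar_support]. *)
Definition eta_bar (k n : nat) : nat :=
  \big[addn/0]_(m \in [set m : nat | 1 <= m])
     ('C(m + k - 1, 2 * k) * rank_count m%:Z n).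

(* The k columns of the array together with the side D of the square. *)
Definition durfee_array (k : nat) : Type :=
  (k.-tuple (seq nat * seq nat) * nat)%type.

HB.instance Definition _ k := Choice.on (durfee_array k).

(* The superscripts run from 1 to k; the column with superscript j is stored at
   position j - 1. *)
Definition alpha k (t : durfee_array k) (j : nat) : seq nat :=
  (nth ([::], [::]) t.1 (j - 1)).1.
Definition beta k (t : durfee_array k) (j : nat) : seq nat :=
  (nth ([::], [::]) t.1 (j - 1)).2.
Definition side k (t : durfee_array k) : nat := t.2.

(* In [md_bound] the bounds for j < k follow from those for j = k and
   [md_chain], unless both partitions of the k-th column are empty.  In that case [md_chain] puts no
   upper bound on the parts of the (k-1)-th column, and they must still be at
   most D, as the parts of any Durfee symbol. *)
Record marked_durfee (k n : nat) (t : durfee_array k) : Prop := MarkedDurfee {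
  md_alpha_partition : forall j, 1 <= j <= k -> is_partition (alpha t j);
  md_beta_partition : forall j, 1 <= j <= k -> is_partition (beta t j);
  md_side_gt0 : 0 < side t;
  md_alpha_neq0 : forall j, 1 <= j < k -> alpha t j <> [::];
  md_chain : forall j, 2 <= j <= k ->
    [/\ largest_part (beta t (j - 1)) <= largest_part (alpha t (j - 1)),
        alpha t j <> [::] ->
          largest_part (alpha t (j - 1)) <= smallest_part (alpha t j)
      & beta t j <> [::] ->
          largest_part (alpha t (j - 1)) <= smallest_part (beta t j)];
  md_bound : forall j, 1 <= j <= k ->
    largest_part (alpha t j) <= side t /\ largest_part (beta t j) <= side t;
  md_weight :
    \sum_(1 <= j < k.+1) (sumn (alpha t j) + sumn (beta t j)) + side t ^ 2 = n
}.

Definition durfee_rank k (j : nat) (t : durfee_array k) : int :=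
  (if (j < k)%N then (size (alpha t j))%:Z - (size (beta t j))%:Z - 1
   else (size (alpha t j))%:Z - (size (beta t j))%:Z)%R.

Definition bounded_seq n (s : n.-bseq 'I_n.+1) : seq nat :=
  map (@nat_of_ord n.+1) s.

Lemma bounded_seqP n (s : seq nat) : is_partition s -> sumn s <= n ->
  exists b : n.-bseq 'I_n.+1, bounded_seq b = s.
Proof.
move=> /andP[_ s0] sn.
have szs : size s <= sumn s.
  elim: s s0 {sn} => [//|x s IH]; rewrite inE negb_or => /andP[x0 /IH h] /=.
  by rewrite -add1n leq_add // lt0n eq_sym.
have les x : x \in s -> x <= sumn s.
  elim: s {s0 sn szs} => [//|y s IH]; rewrite inE => /orP[/eqP->|/IH h] /=.
    exact: leq_addr.
  exact: leq_trans h (leq_addl _ _).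
have szb : size (map (@inord n) s) <= n by rewrite size_map (leq_trans szs).
exists (Bseq szb); rewrite /bounded_seq /= -map_comp map_id_in // => x xs /=.
by rewrite inordK // ltnS (leq_trans (les _ xs)).
Qed.

Lemma finite_partitions n : finite_set (partitions_of n).
Proof.
apply: (@sub_finite_set _ _ (range (@bounded_seq n))).
  move=> s [ps sn]; have [|b <-] := @bounded_seqP n s ps; first by rewrite sn.
  by exists b.
by apply: finite_image; exact: finite_finset.
Qed.

Lemma finite_marked_durfee k n : finite_set (@marked_durfee k n).
Proof.
pose B := n.-bseq 'I_n.+1.
pose f (x : k.-tuple (B * B) * 'I_n.+1) : durfee_array k :=
  ([tuple of map (fun c => (bounded_seq c.1, bounded_seq c.2)) x.1], val x.2).
apply: (@sub_finite_set _ _ (range f)); last first.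
  by apply: finite_image; exact: finite_finset.
move=> t mt.
have cexP (j : 'I_k) : exists c : B * B,
    (bounded_seq c.1, bounded_seq c.2) = tnth t.1 j.
  have jk : 1 <= j.+1 <= k by rewrite ltn_ord.
  have le_n : sumn (alpha t j.+1) + sumn (beta t j.+1) <= n.
    rewrite -(md_weight mt) (bigD1_seq j.+1) ?iota_uniq ?mem_index_iota //=.
    by rewrite -addnA leq_addr.
  have [|a ea] := bounded_seqP (n := n) (md_alpha_partition mt jk).
    exact: leq_trans (leq_addr _ _) le_n.
  have [|b eb] := bounded_seqP (n := n) (md_beta_partition mt jk).
    exact: leq_trans (leq_addl _ _) le_n.
  exists (a, b); rewrite /= ea eb /alpha /beta subn1 /= (tnth_nth ([::], [::])).
  by case: (nth _ _ _).
have sn : t.2 < n.+1.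
  rewrite ltnS -(md_weight mt); apply: leq_trans (leq_addl _ _).
  by rewrite /side -mulnn; case: (t.2) => // d; rewrite leq_pmulr.
exists ([tuple projT1 (cid (cexP j)) | j < k], Ordinal sn) => //.
rewrite /f /=; case: t {mt} cexP sn => c d /= cexP sn; congr pair.
apply: eq_from_tnth => j; rewrite tnth_map tnth_mktuple.
by case: (cid _).
Qed.

Lemma rank_count_eq0 (m n : nat) : n < m -> rank_count m%:Z n = 0.
Proof.
move=> nm; rewrite /rank_count /count_set (_ : [set s | _] = set0).
  by rewrite fset_set0 cardfs0.
apply/seteqP; split=> // s [[_ sn] rs].
have le_head : largest_part s <= sumn s by case: s {sn rs} => //= x s; exact: leq_addr.
have : (m%:Z <= (largest_part s)%:Z)%R.
  by rewrite -rs /partition_rank lerBlDr lerDl.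
by rewrite lez_nat leqNgt (leq_ltn_trans le_head) // sn.
Qed.

Lemma finite_eta_bar_support n :
  finite_set [set m : nat | rank_count m%:Z n <> 0].
Proof.
apply: (@sub_finite_set _ _ (range (@nat_of_ord n.+1))).
  move=> m /= mn0; have [mn|nm] := ltnP m n.+1; first by exists (Ordinal mn).
  by case: mn0; exact: rank_count_eq0.
by apply: finite_image; exact: finite_finset.
Qed.

(* Main.v *)
(* Fix the side D. Building a symbol by inserting parts of size r = 1, .., D, and
   closing the current column with a part r when passing to the next one, the
   generating function of the symbols is the (1, k) entry of the product over r
   of the matrices (1 - q^r S + q^(2r))^-1, where S is bidiagonal with diagonal
   entries s_j = x_j + 1/x_j and superdiagonal 1. For k = 1 this is the
   generating function, by rank, of the partitions with Durfee square of side D.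
   Hence the former is obtained from the latter by replacing x^m + x^-m,
   a polynomial in s, by its divided difference at s_1, .., s_k. With x_j = 1 for
   j <> i the coefficients of this divided difference are binomials ([kernel]),
   and summing those with positive exponent of x_i gives C(m+k-1, 2k) for k+1
   columns. On coefficients, the inverse matrices amount to a linear recurrence in
   D, which determines the counts. *)
Require Import Defs.
From mathcomp Require Import all_boot all_order all_algebra.
From mathcomp Require Import finmap.
From mathcomp Require Import boolp classical_sets functions cardinality fsbigop.
From mathcomp Require Import zify ring.

Import Order.TTheory GRing.Theory Num.Theory.

Local Open Scope classical_set_scope.

(** * Counting finite sets *)

Lemma count_set_bij (S T : choiceType) (A : set S) (B : set T) (f : S -> T)
    (g : T -> S) : finite_set A ->
  (forall x, A x -> B (f x) /\ g (f x) = x) ->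
  (forall y, B y -> A (g y) /\ f (g y) = y) ->
  count_set A = count_set B.
Proof.
move=> finA AB BA.
have -> : B = f @` A.
  apply/seteqP; split=> [y /BA [Ag fg]|y [x /AB [Bf _] <-] //].
  by exists (g y).
rewrite /count_set fset_set_image // card_in_imfset //= => x y.
rewrite !in_fset_set // !inE => /AB [_ gx] /AB [_ gy] e.
by rewrite -gx e gy.
Qed.

Lemma count_setID (T : choiceType) (A B : set T) : finite_set A ->
  count_set A = count_set (A `&` B) + count_set (A `&` ~` B).
Proof.
move=> finA; rewrite /count_set.
have fI : finite_set (A `&` B) by apply: finite_setI; left.
have fC : finite_set (A `&` ~` B) by apply: finite_setI; left.
rewrite -[A in LHS](setUIDK _ B) fset_setU // cardfsU -fset_setI //.
by rewrite setIACA setICr !setI0 fset_set0 cardfs0 subn0.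
Qed.

Lemma count_set_fibers (T : choiceType) (A : set T) (f : T -> nat) (N : nat) :
  finite_set A -> (forall x, A x -> 1 <= f x <= N) ->
  count_set A = \sum_(1 <= i < N.+1) count_set (A `&` [set x | f x = i]).
Proof.
elim: N A => [|N IH] A finA fN.
  rewrite big_nil (_ : A = set0) ?/count_set ?fset_set0 ?cardfs0 //.
  by apply/seteqP; split=> // x /fN; case: (f x).
rewrite big_nat_recr //= (@count_setID _ A [set x | f x = N.+1]) // addnC.
congr (_ + _); rewrite (IH (A `&` _)).
- apply: eq_big_nat => i /andP[_ iN]; congr count_set.
  apply/seteqP; split=> x /=; first by case=> -[].
  by case=> Ax fx; do !split=> //; lia.
- by apply: finite_setI; left.
- by move=> x [/fN fx] /= /eqP; lia.
Qed.

(** * The recurrence and the divided differences solving it *)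

Local Open Scope ring_scope.

(* [f j D m w] plays the role of the number of symbols with [j] columns, parts
   at most [D], [i]-th rank [m] and weight [w]; the recurrence removes the parts
   equal to [D.+1], which is why it lowers the weight by at least 1. *)
Definition level_recurrence (i : nat) (N : int)
    (f : nat -> nat -> int -> int -> int) : Prop :=
  forall j D m w, w < N ->
    f j.+1 D.+1 m w =
      f j.+1 D.+1 (m - (i == j.+1)%:Z) (w - D.+1%:Z)
      + f j.+1 D.+1 (m + (i == j.+1)%:Z) (w - D.+1%:Z)
      - f j.+1 D.+1 m (w - D.+1%:Z - D.+1%:Z)
      + f j.+1 D m w
      + (if j is 0 then 0 else f j D.+1 m (w - D.+1%:Z)).

(** Each term on the right of the recurrence has a smaller [D], a smaller [j] or a smaller weight,
    so nested inductions on [D], [j] and the absolute value of [w] lead back to negative weights and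
    to [D = 0]. *)
Lemma level_recurrence_uniq (i : nat) (N : int)
    (f g : nat -> nat -> int -> int -> int) :
  level_recurrence i N f -> level_recurrence i N g ->
  (forall j D m w, w < 0 -> f j.+1 D m w = g j.+1 D m w) ->
  (forall j m w, f j.+1 0%N m w = g j.+1 0%N m w) ->
  forall j D m w, w < N -> f j.+1 D m w = g j.+1 D m w.
Proof.
move=> rf rg fg_neg fg0 j D; elim: D j => [|D IHD] j m w wN; first exact: fg0.
elim: j m w wN => [|j IHj] m w wN.
  have [v] := ubnP (absz w); elim: v m w wN => // v IHv m w wN wv.
  have [w0|w0] := ltP w 0; first exact: fg_neg.
  have step m' w' : w' < w -> f 1%N D.+1 m' w' = g 1%N D.+1 m' w'.
    by move=> ww; have [/fg_neg //|w'0] := ltP w' 0; apply: IHv; lia.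
  by rewrite rf // rg // !step ?IHD //; lia.
have [v] := ubnP (absz w); elim: v m w wN => // v IHv m w wN wv.
have [w0|w0] := ltP w 0; first exact: fg_neg.
have step m' w' : w' < w -> f j.+2 D.+1 m' w' = g j.+2 D.+1 m' w'.
  by move=> ww; have [/fg_neg //|w'0] := ltP w' 0; apply: IHv; lia.
by rewrite rf // rg // !step ?IHD ?IHj //; lia.
Qed.

(** * Sums over symmetric intervals *)

Definition sum_sym (N : nat) (u : int -> int) : int :=
  \sum_(0 <= q < N.*2.+1) u (q%:Z - N%:Z).

Lemma sum_sym_shift (N : nat) (u : int -> int) :
  sum_sym N (fun p => u (p + 1)) = sum_sym N u + u (N%:Z + 1) - u (- N%:Z).
Proof.
rewrite /sum_sym [in RHS]big_nat_recl //= [in LHS]big_nat_recr //=.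
have -> : \sum_(0 <= q < N.*2) u (q%:Z - N%:Z + 1)
        = \sum_(0 <= q < N.*2) u (q.+1%:Z - N%:Z).
  by apply: eq_bigr => q _; congr u; lia.
have -> : N.*2%:Z - N%:Z + 1 = N%:Z + 1 by lia.
by rewrite sub0r; set S := (\sum_(0 <= q < _) _); ring.
Qed.

Lemma sum_symD (N : nat) (u v : int -> int) :
  sum_sym N (fun p => u p + v p) = sum_sym N u + sum_sym N v.
Proof. exact: big_split. Qed.

Lemma eq_sum_sym (N : nat) (u v : int -> int) :
  u =1 v -> sum_sym N u = sum_sym N v.
Proof. by move=> uv; apply: eq_bigr. Qed.

(** Summation by parts: shifting the index changes a sum only at its ends, where [u] vanishes. This
    moves the recurrence in [p] from the counts to the kernel. *)
Lemma sum_sym_adjoint (N : nat) (a u : int -> int) :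
  (forall p, N%:Z <= `|p| -> u p = 0) ->
  sum_sym N (fun p => a p * (u (p - 1) + u (p + 1))) =
  sum_sym N (fun p => (a (p - 1) + a (p + 1)) * u p).
Proof.
move=> u0.
have -> : sum_sym N (fun p => a p * (u (p - 1) + u (p + 1))) =
    sum_sym N (fun p => a p * u (p - 1)) + sum_sym N (fun p => a p * u (p + 1)).
  by rewrite -sum_symD; apply: eq_sum_sym => p; rewrite mulrDr.
have -> : sum_sym N (fun p => (a (p - 1) + a (p + 1)) * u p) =
    sum_sym N (fun p => a (p - 1) * u p) + sum_sym N (fun p => a (p + 1) * u p).
  by rewrite -sum_symD; apply: eq_sum_sym => p; rewrite mulrDl.
rewrite addrC; congr (_ + _).
  have := sum_sym_shift N (fun p => a (p - 1) * u p).
  rewrite !u0 ?mulr0 ?addr0 ?subr0; try lia.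
  move=> <-; apply: eq_sum_sym => p; congr (a _ * _); lia.
have := sum_sym_shift N (fun p => a p * u (p - 1)).
rewrite !u0 ?mulr0 ?addr0 ?subr0; try lia.
move=> <-; apply: eq_sum_sym => p; congr (a _ * u _); lia.
Qed.

Lemma sum_sym_even (N : nat) (u : int -> int) : u 0 = 0 ->
  (forall p, u (- p) = u p) ->
  sum_sym N u = 2 * \sum_(1 <= p < N.+1) u p%:Z.
Proof.
move=> u0 uN.
have -> : sum_sym N u = u 0 + 2 * \sum_(1 <= p < N.+1) u p%:Z.
  elim: N => [|N IH].
    by rewrite /sum_sym big_nat1 big_nil mulr0 addr0 subr0.
  rewrite big_nat_recr //= mulrDr addrA -IH /sum_sym doubleS.
  rewrite big_nat_recl //= big_nat_recr //=.
  have -> : N.*2.+2%:Z - N.+1%:Z = N.+1%:Z by lia.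
  rewrite sub0r uN [_ + u N.+1%:Z]addrC addrA mulr_natl mulr2n addrC.
  congr (_ + _); apply: eq_bigr => q _; congr u; lia.
by rewrite u0 add0r.
Qed.

(* The coefficient of [x ^ m] in the divided difference of [x ^ p + x ^ (- p)],
   seen as a polynomial in [s = x + 1/x], at [s_1, .., s_j], where [s_i = s] and
   the other nodes are 2.  The truncated subtractions only occur where the
   binomial takes the right value anyway. *)
Definition kernel (i j : nat) (m p : int) : int :=
  if (j < i)%N then
    if m == 0 then
      ('C(absz p + j - 2, j.*2 - 2) + 'C(absz p + j - 1, j.*2 - 2))%N%:Z
    else 0
  else if j == 1%N then (p == m)%:Z + (p == - m)%:Z
  else 'C(absz p - absz m + j - 2, j.*2 - 3)%N%:Z.

(** * Recurrence, initial values and sums of the divided differences *)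

Lemma bin_second_difference (q r : nat) :
  ('C(q.+2, r.+2) + 'C(q, r.+2) = 2 * 'C(q.+1, r.+2) + 'C(q, r))%N.
Proof. by rewrite !binS; lia. Qed.

Lemma kernel_below (i j : nat) (m p : int) : (j.+1 < i)%N ->
  kernel i j.+1 m p = (m == 0)%:Z *
    ('C(absz p + j - 1, j.*2) + 'C(absz p + j, j.*2))%N%:Z.
Proof.
move=> ji; rewrite /kernel ji.
have -> : (absz p + j.+1 - 2 = absz p + j - 1)%N by lia.
have -> : (absz p + j.+1 - 1 = absz p + j)%N by lia.
have -> : (j.+1.*2 - 2 = j.*2)%N by lia.
by case: eqP => _; rewrite ?mul1r ?mul0r.
Qed.

Lemma kernel_above (i j : nat) (m p : int) : (i <= j.+2)%N ->
  kernel i j.+2 m p = 'C(absz p - absz m + j, j.*2.+1)%N%:Z.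
Proof.
move=> ij; rewrite /kernel ltnNge ij /=.
by congr (Posz 'C(_, _)); lia.
Qed.

Lemma kernel_below_rec (i j : nat) (m p : int) : (j.+1 < i)%N ->
  kernel i j.+1 m (p - 1) + kernel i j.+1 m (p + 1) =
  2 * kernel i j.+1 m p + (if j is 0 then 0 else kernel i j m p).
Proof.
case: j => [|j] ji; rewrite !kernel_below ?(ltnW ji) //.
  by rewrite !bin0; lia.
(* Only absolute values enter: if [absz p = a.+1], the neighbours of [p] have absolute values [a]
   and [a.+2] in some order, while both are 1 for [p = 0]. *)
have [[->]|[a [pa]]] : (p = 0) \/ exists a : nat,
    absz p = a.+1 /\ [\/ (absz (p - 1) = a /\ absz (p + 1) = a.+2)
                     | (absz (p - 1) = a.+2 /\ absz (p + 1) = a)].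
  have [->|p0] := eqVneq p 0; [by left|right]; exists (absz p).-1; lia.
  have -> : absz (0 - 1) = 1%N by []. have -> : absz (0 + 1) = 1%N by [].
  rewrite absz0; case: j ji => [|j] _; first by case: (m == 0).
  by rewrite !bin_small; lia.
have D1 := bin_second_difference (a + j) j.*2.
have D2 := bin_second_difference (a + j).+1 j.*2.
rewrite pa; have -> : (a.+1 + j.+1 - 1 = (a + j).+1)%N by lia.
have -> : (a.+1 + j.+1 = (a + j).+2)%N by lia.
have -> : (a.+1 + j - 1 = a + j)%N by lia.
have -> : (a.+1 + j = (a + j).+1)%N by lia.
by case=> -[-> ->]; rewrite doubleS !addnS !subn1 /= !addSn -!mulrDr mulrCA -mulrDr;
  congr (_ * _); lia.
Qed.

Lemma kernel_above_rec (i j : nat) (m p : int) : (0 < i <= j.+1)%N ->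
  kernel i j.+2 m (p - 1) + kernel i j.+2 m (p + 1) =
  2 * kernel i j.+2 m p + kernel i j.+1 m p.
Proof.
move=> ij; rewrite !kernel_above; try lia.
case: j ij => [|j] ij.
  rewrite !addn0 !bin1; have -> : i = 1%N by lia.
  by rewrite /kernel /=; lia.
rewrite kernel_above; last lia.
(* In this range the truncated differences are at most 1, so every binomial vanishes. *)
have [pm|] := leqP (absz p) (absz m).
  have -> : (absz p - absz m = 0)%N by lia.
  by rewrite !bin_small; lia.
move=> mp; have [a pa] : exists a, (absz p - absz m = a.+1)%N.
  by exists (absz p - absz m).-1; lia.
have D := bin_second_difference (a + j).+1 j.*2.+1.
have [[-> ->]|[-> ->]] :
    [\/ (absz (p - 1)%R - absz m = a /\ absz (p + 1)%R - absz m = a.+2)%N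
      | (absz (p - 1)%R - absz m = a.+2 /\ absz (p + 1)%R - absz m = a)%N] by lia.
  by rewrite pa doubleS !addSn !addnS; lia.
by rewrite pa doubleS !addSn !addnS; lia.
Qed.

Lemma kernel_diag_rec (i : nat) (m p : int) :
  kernel i.+1 i.+1 m (p - 1) + kernel i.+1 i.+1 m (p + 1) =
  kernel i.+1 i.+1 (m - 1) p + kernel i.+1 i.+1 (m + 1) p
  + (if i is 0 then 0 else kernel i.+1 i m p).
Proof.
case: i => [|i]; first by rewrite /kernel /=; lia.
rewrite !kernel_above // kernel_below //.
(* For nonzero [m] the lower kernel is 0, and moving [p] or [m] by one gives the same two truncated
   differences up to order. For [m = 0] both neighbours of [m] have absolute value 1, and the lower
   kernel makes up the defect. *)
have [->|m0] := eqVneq m 0; last first.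
  rewrite mul0r addr0.
  have [->|p0] := eqVneq p 0; first by rewrite !bin_small; lia.
  have [pm|mp] := leqP (absz p) (absz m); last first.
    by rewrite -!PoszD; congr Posz;
      have [p1|p1] := leP p 0; have [m1|m1] := leP m 0;
      try (rewrite addnC; congr ('C(_, _) + 'C(_, _))%N; lia);
      congr ('C(_, _) + 'C(_, _))%N; lia.
  rewrite -!PoszD; congr Posz.
    by have [p1|p1] := leP p 0; have [m1|m1] := leP m 0;
      try (rewrite addnC; congr ('C(_, _) + 'C(_, _))%N; lia);
      congr ('C(_, _) + 'C(_, _))%N; lia.
have [->|p0] := eqVneq p 0.
  case: i => [|i] //=; rewrite !bin_small; lia.
have [a pa] : exists a, absz p = a.+1 by exists (absz p).-1; lia.
have E1 : ('C((a + i).+2, i.*2.+1) =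
  'C(a + i, i.*2.+1) + 'C(a + i, i.*2) + 'C((a + i).+1, i.*2))%N.
  by rewrite binS [in LHS]binS; lia.
have [[-> ->]|[-> ->]] :
    [\/ (absz (p - 1) = a /\ absz (p + 1) = a.+2)
      | (absz (p - 1) = a.+2 /\ absz (p + 1) = a)] by lia.
  have -> : (absz p - absz (0 - 1)%R = a)%N by lia.
  by rewrite pa !subn0 mul1r !addSn subn1 /=; lia.
have -> : (absz p - absz (0 - 1)%R = a)%N by lia.
by rewrite pa !subn0 mul1r !addSn subn1 /=; lia.
Qed.

(** Leibniz rule: for g = x^p + x^(-p), the product s g is the sum of the functions belonging to p -
    1 and p + 1. Its divided difference at j + 1 nodes is s_(j+1) times that of g, plus that of g at
    the first j nodes. The factor s_(j+1) shifts [m] both ways if [i = j.+1] and is 2 otherwise. *)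
Lemma kernel_rec (i j : nat) (m p : int) : (0 < i)%N ->
  kernel i j.+1 m (p - 1) + kernel i j.+1 m (p + 1) =
  kernel i j.+1 (m - (i == j.+1)%:Z) p + kernel i j.+1 (m + (i == j.+1)%:Z) p
  + (if j is 0 then 0 else kernel i j m p).
Proof.
move=> i0; case: (ltngtP j.+1 i) => [ji|ji|<-]; last exact: kernel_diag_rec.
  by rewrite subr0 ?addr0 -mulr2n -mulr_natl kernel_below_rec.
rewrite subr0 ?addr0 -mulr2n -mulr_natl; case: j ji => [|j] ji; first by lia.
by rewrite kernel_above_rec // i0.
Qed.

(** For [p = 0] the function is the constant 2, whose divided differences vanish from two nodes
    on. *)
Lemma kernel0 (i j : nat) (m : int) : (0 < i)%N ->
  kernel i j.+1 m 0 = 2 * ((j == 0%N) && (m == 0))%:Z.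
Proof.
move=> i0; have [ji|ij] := ltnP j.+1 i.
  rewrite kernel_below //; case: j ji => [|j] _; first by case: (m == 0).
  by rewrite !bin_small; lia.
case: j ij => [|j] ij; last by rewrite kernel_above // bin_small; lia.
have -> : i = 1%N by lia.
by rewrite /kernel /=; lia.
Qed.

Lemma hockey_stick (k P N : nat) : (P <= N)%N ->
  (\sum_(1 <= m < N.+1) 'C(P - m + k, k.*2.+1) = 'C(P + k, k.*2.+2))%N.
Proof.
elim: P N => [|P IH] N PN.
  rewrite big_nat big1 ?bin_small; try lia.
  by move=> m _; rewrite sub0n bin_small; lia.
case: N PN => // N PN; rewrite big_nat_recl //= subn1 addSn binS addnC.
by congr (_ + _)%N; rewrite -(IH N) //; apply: eq_bigr.
Qed.

(** This is the source of the binomial in [eta_bar], taken there at [k.+1]. *)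
Lemma sum_kernel (i k N : nat) (p : int) : (i <= k.+2)%N -> (absz p <= N)%N ->
  \sum_(1 <= m < N.+1) kernel i k.+2 m%:Z p = 'C(absz p + k, k.*2.+2)%:Z.
Proof.
move=> ik pN; rewrite -(hockey_stick k _ N pN) -[RHS]natz natr_sum.
by apply: eq_bigr => m _; rewrite kernel_above // natz.
Qed.

(** * Marked symbols as lists of columns *)

Local Open Scope nat_scope.

Local Notation column := (seq nat * seq nat)%type.

Definition link (c c' : column) : bool :=
  [&& largest_part c'.2 <= largest_part c'.1,
      (c.1 == [::]) || (largest_part c'.1 <= smallest_part c.1)
    & (c.2 == [::]) || (largest_part c'.1 <= smallest_part c.2)].

(* The column with the highest superscript comes first, so that the symbol is
   built by consing onto its head. *)
Definition valid (D : nat) (L : seq column) : bool :=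
  [&& all (fun c => is_partition c.1 && is_partition c.2) L,
      all (fun c => (largest_part c.1 <= D) && (largest_part c.2 <= D)) L,
      all (fun c => c.1 != [::]) (behead L)
    & sorted link L].

Definition weight (L : seq column) : nat :=
  \sum_(c <- L) (sumn c.1 + sumn c.2).

(** In the reversed list, superscript [i] sits at position [size L - i]. The value 0 for a column
    not yet present agrees with [kernel], which for [j < i] is supported at [m = 0]. *)
Definition col_rank (i : nat) (L : seq column) : int :=
  if size L < i then 0%R else
  let c := nth ([::], [::]) L (size L - i) in
  ((size c.1)%:Z - (size c.2)%:Z - (i < size L)%:Z)%R.

Lemma marked_durfeeP (k n : nat) (t : durfee_array k) :
  marked_durfee n t <->
  [/\ 0 < side t, valid (side t) (rev t.1) & weight (rev t.1) + side t ^ 2 = n].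
Proof.
pose s : seq column := t.1; have sz : size s = k by rewrite size_tuple.
have wE : \sum_(1 <= j < k.+1) (sumn (alpha t j) + sumn (beta t j)) =
    weight (rev t.1).
  rewrite big_add1 /= /weight [RHS](perm_big _ (permEl (perm_rev _))) /=.
  rewrite (big_nth ([::], [::])) size_tuple; apply: eq_bigr => j _.
  by rewrite /alpha /beta subn1.
(* In the reversed list [behead] removes the column of superscript [k], the only one whose upper
   partition may be empty. *)
have behead_rev : behead (rev s) = rev (take k.-1 s).
  by rewrite -drop1 drop_rev sz subn1.
have sztake : size (take k.-1 s) = k.-1 by rewrite size_take sz; case: ifP; lia.
split=> [[aP bP D0 a0 ch bd wt]|[D0 /and4P [p_all b_all a_all ch] wt]].
  split=> //; last by rewrite -wE.
  apply/and4P; split; rewrite ?behead_rev ?all_rev ?rev_sorted.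
  - apply/(all_nthP ([::], [::])) => j; rewrite sz => jk.
    have := conj (aP j.+1) (bP j.+1); rewrite /alpha /beta subn1 /= jk.
    by case=> -> // ->.
  - apply/(all_nthP ([::], [::])) => j; rewrite sz => jk.
    by have := bd j.+1; rewrite /alpha /beta subn1 /= => -[//|-> ->].
  - apply/(all_nthP ([::], [::])) => j; rewrite sztake => jk.
    have := a0 j.+1; rewrite /alpha subn1 /= nth_take // => h.
    by apply/eqP; apply: h; lia.
  - apply/(sortedP ([::], [::])) => j; rewrite sz => jk.
    have := ch j.+2; rewrite /alpha /beta !subn1 /= => -[//| b1 h1 h2].
    rewrite /link b1 /=; apply/andP; split.
      by case: eqP => //= /h1.
    by case: eqP => //= /h2.
rewrite rev_sorted in ch; rewrite all_rev in p_all; rewrite all_rev in b_all.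
rewrite behead_rev all_rev in a_all.
have nthP j : 1 <= j <= k -> j - 1 < size s by rewrite sz; lia.
split=> //; last by rewrite wE.
- by move=> j /nthP /(all_nthP ([::], [::]) p_all) /andP [].
- by move=> j /nthP /(all_nthP ([::], [::]) p_all) /andP [].
- move=> j jk; have := all_nthP ([::], [::]) a_all (j - 1).
  by rewrite sztake nth_take ?[_ < k.-1]/=; try lia; move=> h; apply/eqP/h; lia.
- move=> j jk; have := sortedP ([::], [::]) ch (j - 2); rewrite sz => h.
  have {h} := h ltac:(lia).
  have -> : (j - 2).+1 = j - 1 by lia.
  rewrite /alpha /beta -subnDA /= => /and3P [h1 h2 h3]; split=> //.
    by move=> /eqP; move: h2; case: eqP.
  by move=> /eqP; move: h3; case: eqP.
- by move=> j /nthP /(all_nthP ([::], [::]) b_all) /andP [].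
Qed.

Lemma valid_leq (D E : nat) (L : seq column) : D <= E -> valid D L -> valid E L.
Proof.
move=> DE /and4P [h1 h2 h3 h4]; apply/and4P; split=> //.
by apply: sub_all h2 => c /andP [h h']; rewrite !(leq_trans _ DE).
Qed.

Lemma finite_valid (j D w : nat) :
  finite_set [set L | [/\ size L = j, valid D L & weight L = w]].
Proof.
pose f (t : durfee_array j) : seq column := rev t.1.
(* The side [D.+1] is positive even if [D = 0], and still bounds all parts. *)
apply: (@sub_finite_set _ _ (f @` (@marked_durfee j (w + D.+1 ^ 2)))); last first.
  exact/finite_image/finite_marked_durfee.
move=> L [sz vL wL]; have szr : size (rev L) == j by rewrite size_rev sz.
exists (Tuple szr, D.+1); last by rewrite /f /= revK.
apply/marked_durfeeP; rewrite /side /= revK wL.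
by split=> //; apply: valid_leq vL.
Qed.

Lemma is_partition_cons (d : nat) (s : seq nat) :
  is_partition (d :: s) = [&& 0 < d, largest_part s <= d & is_partition s].
Proof.
rewrite /is_partition inE negb_or /= eq_sym -lt0n.
case: s => [|x s] /=; first by rewrite !andbT.
by case: (x <= d); case: (0 < d); rewrite /= ?andbF.
Qed.

Lemma smallest_leq_largest (s : seq nat) :
  is_partition s -> smallest_part s <= largest_part s.
Proof.
case: s => [//|x s] /andP [/= ps _]; rewrite /smallest_part /largest_part /=.
have geq_tr : transitive geq by move=> a b c /= ba ac; exact: leq_trans ac ba.
have := mem_last x s; rewrite inE => /orP [/eqP -> //|].
by move/(allP (order_path_min geq_tr ps)).
Qed.

Lemma valid1 (D : nat) (c : column) : valid D [:: c] =
  [&& is_partition c.1, is_partition c.2, largest_part c.1 <= D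
    & largest_part c.2 <= D].
Proof. by rewrite /valid /= !andbT -!andbA. Qed.

Lemma valid2 (D : nat) (c y : column) (L : seq column) :
  valid D (c :: y :: L) =
  [&& valid D [:: c], y.1 != [::], link c y & valid D (y :: L)].
Proof.
rewrite valid1 /valid /= -!andbA.
by do !bool_congr.
Qed.

(** Along the chain each column is bounded by the smallest part of the nonempty upper partition of
    the column before it, so the first upper partition bounds everything. This allows the bound [D]
    to be lowered. *)
Lemma valid_largest (D : nat) (y : column) (L : seq column) :
  y.1 != [::] -> largest_part y.2 <= largest_part y.1 ->
  valid D (y :: L) -> valid (largest_part y.1) (y :: L).
Proof.
elim: L y => [|z L IH] y y0 yy.
  by rewrite !valid1 => /and4P [-> ->]; rewrite leqnn yy.
rewrite !valid2 => /and4P [vy z0 lyz vz].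
move: (lyz) => /and3P [zz]; rewrite (negbTE y0) /= => zy _.
apply/and4P; split=> //.
  by move: vy; rewrite !valid1 leqnn yy => /and4P [-> ->].
apply: valid_leq (IH z z0 zz vz); apply: leq_trans zy _.
by apply: smallest_leq_largest; move: vy; rewrite valid1 => /and4P [].
Qed.

Definition push_alpha (d : nat) (L : seq column) : seq column :=
  if L is c :: L' then (d :: c.1, c.2) :: L' else [::].
Definition pop_alpha (L : seq column) : seq column :=
  if L is c :: L' then (behead c.1, c.2) :: L' else [::].
Definition push_beta (d : nat) (L : seq column) : seq column :=
  if L is c :: L' then (c.1, d :: c.2) :: L' else [::].
Definition pop_beta (L : seq column) : seq column :=
  if L is c :: L' then (c.1, behead c.2) :: L' else [::].

(** A part equal to the global bound can always be put in front. The smallest part changes only if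
    the partition was empty, and then the link to the next column holds by the global bound. *)
Lemma valid_push_alpha (d : nat) (c : column) (L : seq column) :
  valid d.+1 ((d.+1 :: c.1, c.2) :: L) = valid d.+1 (c :: L).
Proof.
case: c => a b; case: L => [|y L].
  by rewrite !valid1 /= is_partition_cons leqnn /=;
    case: (is_partition a); case: (is_partition b); case: (largest_part a <= _);
    case: (largest_part b <= _).
rewrite !valid2 !valid1 /= is_partition_cons leqnn /=.
case vy : (valid d.+1 (y :: L)); last by rewrite !andbF.
rewrite {1 2}/link /=; have -> : (largest_part y.1 <= smallest_part (d.+1 :: a))
    = (a == [::]) || (largest_part y.1 <= smallest_part a).
  case: a => [|x a] //=; rewrite /smallest_part /=.
  by move: vy; case: L => [|z L]; rewrite ?valid2 valid1 => /and4P [] // /and4P [].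
by case: (is_partition a); case: (is_partition b); case: (largest_part a <= _);
  case: (largest_part b <= _).
Qed.

Lemma valid_push_beta (d : nat) (c : column) (L : seq column) :
  valid d.+1 ((c.1, d.+1 :: c.2) :: L) = valid d.+1 (c :: L).
Proof.
case: c => a b; case: L => [|y L].
  by rewrite !valid1 /= is_partition_cons leqnn /=;
    case: (is_partition a); case: (is_partition b); case: (largest_part a <= _);
    case: (largest_part b <= _).
rewrite !valid2 !valid1 /= is_partition_cons leqnn /=.
case vy : (valid d.+1 (y :: L)); last by rewrite !andbF.
rewrite {1 2}/link /=; have -> : (largest_part y.1 <= smallest_part (d.+1 :: b))
    = (b == [::]) || (largest_part y.1 <= smallest_part b).
  case: b => [|x b] //=; rewrite /smallest_part /=.
  by move: vy; case: L => [|z L]; rewrite ?valid2 valid1 => /and4P [] // /and4P [].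
by case: (is_partition a); case: (is_partition b); case: (largest_part a <= _);
  case: (largest_part b <= _).
Qed.

Lemma weight_cons (c : column) (L : seq column) :
  weight (c :: L) = sumn c.1 + sumn c.2 + weight L.
Proof. by rewrite /weight big_cons. Qed.

(** Column [i] ceases to be the last one when a column is consed onto a list of size [i]; from then
    on its rank carries the summand -1. *)
Lemma col_rank_cons (i : nat) (c : column) (L : seq column) :
  0 < i -> col_rank i (c :: L) =
  if i == (size L).+1 then ((size c.1)%:Z - (size c.2)%:Z)%R
  else (col_rank i L - (i == size L)%:Z)%R.
Proof.
move=> i0; rewrite /col_rank /=.
have [iL|iL] := leqP i (size L).
  rewrite [_ < i]ltnNge ltnS iL leqW //= subSn //= [i == _.+1]ltn_eqF //.
  by case: ltngtP iL => // _ _; rewrite ?subr0.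
by rewrite ltn_neqAle iL andbT eq_sym; case: eqVneq => [->|_] /=;
  rewrite ?subnn ?ltnn ?(gtn_eqF iL) /= subr0.
Qed.

(** * Recurrence for the numbers of symbols *)

(** The weight is an integer so that the subtractions in the recurrence are not truncated; negative
    weights give the empty set. *)
Definition symbols (i j D : nat) (m w : int) : set (seq column) :=
  [set L | [/\ size L = j, valid D L, Posz (weight L) = w & col_rank i L = m]].

Lemma finite_symbols (i j D : nat) (m w : int) :
  finite_set (symbols i j D m w).
Proof.
apply: sub_finite_set (finite_valid j D (absz w)) => L [sz vL wL _].
by split=> //; rewrite -wL.
Qed.

Definition nsym (i j D : nat) (m w : int) : int :=
  Posz (count_set (symbols i j D m w)).

Definition alpha_has (d : nat) : set (seq column) :=
  [set L | largest_part (head ([::], [::]) L).1 = d].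
Definition beta_has (d : nat) : set (seq column) :=
  [set L | largest_part (head ([::], [::]) L).2 = d].

(** The closing part [d] lengthens the upper partition by one, which cancels the -1 in the rank of a
    column that is no longer last. *)
Lemma col_rank_close (i d : nat) (a b : seq nat) (L : seq column) : 0 < i ->
  col_rank i (([::], [::]) :: (d :: a, b) :: L) = col_rank i ((a, b) :: L).
Proof.
move=> i0; have [Li|Li] := ltnP (size L).+1 i; last first.
  by rewrite !col_rank_cons //=; do ![case: eqVneq => ?]; lia.
rewrite !col_rank_cons //= /col_rank (ltnW Li).
by do ![case: eqVneq => ?]; lia.
Qed.

Lemma count_alpha_has (i j d : nat) (m w : int) : 0 < i ->
  count_set (symbols i j.+1 d.+1 m w `&` alpha_has d.+1) =
  count_set (symbols i j.+1 d.+1 (m - (i == j.+1)%:Z)%R (w - d.+1%:Z)%R).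
Proof.
move=> i0; apply: (@count_set_bij _ _ _ _ pop_alpha (push_alpha d.+1)).
- by apply: finite_setI; left; exact: finite_symbols.
- case=> [|[[|x a] b] L] [[sz vL wL rL]] // xd; rewrite /alpha_has /= in xd.
  subst x; split=> //; split=> //; first by rewrite -(valid_push_alpha d (a, b)).
    by rewrite -wL !weight_cons /=; lia.
  by rewrite -rL !col_rank_cons // -sz /=; case: eqVneq => _; lia.
- case=> [|[a b] L] [sz vL wL rL] //; split; last by [].
  split=> //; split=> //; first by rewrite (valid_push_alpha d (a, b)).
    by move: wL; rewrite !weight_cons /=; lia.
  by move: rL; rewrite !col_rank_cons // -sz /=; case: eqVneq => _; lia.
Qed.

Lemma count_beta_has (i j d : nat) (m w : int) : 0 < i ->
  count_set (symbols i j.+1 d.+1 m w `&` ~` alpha_has d.+1 `&` beta_has d.+1) =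
  count_set (symbols i j.+1 d.+1 (m + (i == j.+1)%:Z)%R (w - d.+1%:Z)%R
             `&` ~` alpha_has d.+1).
Proof.
move=> i0; apply: (@count_set_bij _ _ _ _ pop_beta (push_beta d.+1)).
- by do 2![apply: finite_setI; left]; exact: finite_symbols.
- case=> [|[a [|x b]] L] [[[sz vL wL rL]] ah] // xd; rewrite /beta_has /= in xd.
  subst x; split=> //; split=> //; split=> //.
  + by rewrite -(valid_push_beta d (a, b)).
  + by rewrite -wL !weight_cons /=; lia.
  + by rewrite -rL !col_rank_cons // -sz /=; case: eqVneq => _; lia.
- case=> [|[a b] L] [[sz vL wL rL] ah] //; split; last by [].
  split=> //; split=> //; split=> //.
  + by rewrite (valid_push_beta d (a, b)).
  + by move: wL; rewrite !weight_cons /=; lia.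
  + by move: rL; rewrite !col_rank_cons // -sz /=; case: eqVneq => _; lia.
Qed.

Lemma count_no_new_part1 (i d : nat) (m w : int) :
  count_set (symbols i 1 d.+1 m w `&` ~` alpha_has d.+1 `&` ~` beta_has d.+1) =
  count_set (symbols i 1 d m w).
Proof.
congr count_set; apply/seteqP; split=> [[|[a b] [|y L]]|[|[a b] [|y L]]] //=.
- by case=> -[[]].
- case=> -[[_ + wL rL]]; rewrite /alpha_has /beta_has /= => vL ah bh.
  split=> //; move: vL; rewrite !valid1 /= => /and4P [-> -> a1 b1] /=.
  by apply/andP; split; lia.
- by case=> -[[]].
- case=> _ vL wL rL; move: (vL); rewrite valid1 /= => /and4P [_ _ ad bd].
  split; first split; first split=> //; first exact: valid_leq vL.
    by rewrite /alpha_has /=; lia.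
  by rewrite /beta_has /=; lia.
- by case.
Qed.

(* A symbol whose last column has no part [d.+1], although the previous column
   does, must have an empty last column: the previous column has just been
   closed by its part [d.+1]. *)
Lemma count_no_new_part2 (i j d : nat) (m w : int) : 0 < i ->
  count_set (symbols i j.+2 d.+1 m w `&` ~` alpha_has d.+1 `&` ~` beta_has d.+1) =
  count_set (symbols i j.+2 d m w)
  + count_set (symbols i j.+1 d.+1 m (w - d.+1%:Z)%R).
Proof.
move=> i0; pose C := [set L | alpha_has d.+1 (behead L)].
have finS : finite_set
    (symbols i j.+2 d.+1 m w `&` ~` alpha_has d.+1 `&` ~` beta_has d.+1).
  by do 2![apply: finite_setI; left]; exact: finite_symbols.
rewrite (@count_setID _ _ C finS) addnC; congr (_ + _).
  congr count_set; apply/seteqP; split=> [[|c [|y L]]|[|c [|y L]]].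
  - by case=> -[[[]]].
  - by case=> -[[[]]].
  - case=> -[[[sz vL wL rL]]]; rewrite /C /alpha_has /beta_has /= => ca cb ya.
    have {}ya : largest_part y.1 <> d.+1 := ya.
    split=> //; move: vL; rewrite !valid2 !valid1.
    move=> /and4P [/and4P [-> -> a1 b1] y0 lcy vy].
    (* Once the upper partition of the previous column has no part [d.+1], [valid_largest] bounds
       all remaining columns by [d]. *)
    have yd : largest_part y.1 <= d.
      have : largest_part y.1 <= d.+1.
        by move: vy; case: (L) => [|z L']; rewrite ?valid2 valid1
          => /and4P [] // /and4P [].
      by lia.
    have yy : largest_part y.2 <= largest_part y.1 by case/and3P: lcy.
    by rewrite y0 lcy (valid_leq _ _ _ yd (valid_largest _ _ _ y0 yy vy)) /=; lia.
  - by case.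
  - by case.
  - case=> sz vL wL rL.
    have small e z L' : valid d (z :: L') -> e = d.+1 ->
        largest_part z.1 <> e /\ largest_part z.2 <> e.
      move=> + ->; case: L' => [|z' L']; rewrite ?valid2 valid1.
        by case/and4P => *; split; lia.
      by case/and4P => /and4P [_ _ z1 z2] *; split; lia.
    have [c1 c2] := small _ _ _ vL erefl.
    have [y1 _] : largest_part y.1 <> d.+1 /\ largest_part y.2 <> d.+1.
      by apply: small erefl; move: vL; rewrite valid2 => /and4P [_ _ _ vy]; exact: vy.
    by do !split=> //; apply: valid_leq vL.
(* Dropping the empty last column and the closing part of the previous one reopens the latter. *)
apply: (@count_set_bij _ _ _ _ (fun L => pop_alpha (behead L))
  (fun L => ([::], [::]) :: push_alpha d.+1 L)).
- by apply: finite_setI; left.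
- case=> [|c [|[[|x a] b] L]]; try by case=> -[[[]]].
  case=> -[[[sz vL wL rL]]]; rewrite /C /alpha_has /beta_has /= => ca cb xd.
  subst x; move: vL; rewrite valid2 valid1.
  move=> /and4P [/and4P [c1 c2 a1 b1] y0 /and3P [yy l1 l2] vy].
  have ce : c = ([::], [::]).
    have h (s : seq nat) : is_partition s -> largest_part s <= d.+1 ->
        largest_part s <> d.+1 ->
        (s == [::]) || (d.+1 <= smallest_part s) -> s = [::].
      move=> ps s1 s2; case: eqP => //= _ s3.
      by have := smallest_leq_largest _ ps; lia.
    by case: (c) ca cb c1 c2 a1 b1 l1 l2 => c' c'' /= *; congr pair; exact: h.
  rewrite ce /= in wL rL *; split=> //; split.
  + by case: sz => <-.
  + by rewrite -(valid_push_alpha d (a, b)).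
  + by rewrite -wL !weight_cons /=; lia.
  + by rewrite -rL col_rank_close.
- case=> [|[a b] L] [sz vL wL rL] //; split; last by [].
  split; last by [].
  split; first split; try by rewrite /alpha_has /beta_has.
  split.
  + by rewrite /= -sz.
  + rewrite /= valid2 valid1 /= (valid_push_alpha d (a, b)) vL andbT /link /= andbT.
    by move: vL; case: (L) => [|z L']; rewrite ?valid2 valid1
      => /and4P [] // /and4P [].
  + by move: wL; rewrite /= !weight_cons /=; lia.
  + by rewrite -rL /= col_rank_close.
Qed.

(** A part [d.+1] is removed from the upper partition if there is one, otherwise from the lower one.
    In the second case the result still has no upper part [d.+1]; discarding the symbols that have
    one produces the negative term, of weight lowered twice. Symbols with neither part give the last
    two terms. *)
Lemma nsym_rec (i : nat) (N : int) : 0 < i -> level_recurrence i N (nsym i).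
Proof.
move=> i0 j d m w _; rewrite /nsym.
have fin := finite_symbols.
rewrite (@count_setID _ _ (alpha_has d.+1) (fin _ _ _ _ _)) count_alpha_has //.
rewrite (@count_setID _ (_ `&` ~` _) (beta_has d.+1)); last first.
  by apply: finite_setI; left; exact: fin.
rewrite count_beta_has //.
have := @count_setID _ _ (alpha_has d.+1)
  (fin i j.+1 d.+1 (m + (i == j.+1)%:Z)%R (w - d.+1%:Z)%R).
rewrite count_alpha_has // addrK.
by case: j => [|j] ->; rewrite ?count_no_new_part1 ?count_no_new_part2 // !PoszD;
  ring.
Qed.

Local Open Scope ring_scope.

Lemma nsym_neg (i j D : nat) (m w : int) : w < 0 -> nsym i j D m w = 0.
Proof.
move=> w0; rewrite /nsym /count_set (_ : symbols _ _ _ _ _ = set0).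
  by rewrite fset_set0 cardfs0.
by apply/seteqP; split=> // L [_ _ wL _]; lia.
Qed.

Lemma largest_part_eq0 (s : seq nat) :
  is_partition s -> (largest_part s <= 0)%N -> s = [::].
Proof. by case: s => // x s; rewrite is_partition_cons; case: x. Qed.

Lemma col_rank_empty (i : nat) : (0 < i)%N -> col_rank i [:: ([::], [::])] = 0.
Proof.
by move=> i0; rewrite col_rank_cons //= /col_rank /= i0 (gtn_eqF i0) subr0 if_same.
Qed.

(** With no parts available there is only the single empty column, since every column but the last
    needs a nonempty upper partition. *)
Lemma nsym0 (i j : nat) (m w : int) : (0 < i)%N ->
  nsym i j.+1 0 m w = ((j == 0)%N && (m == 0) && (w == 0))%:Z.
Proof.
move=> i0; rewrite /nsym /count_set.
case: andP => [[/andP [/eqP -> /eqP ->] /eqP ->]|H]; last first.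
  rewrite (_ : symbols _ _ _ _ _ = set0) ?fset_set0 ?cardfs0 //.
  apply/seteqP; split=> // -[|[a b] [|y L]] [sz vL wL rL] //.
    move: vL; rewrite valid1 => /and4P [pa pb a0 b0].
    have {}pa := largest_part_eq0 _ pa a0; have {}pb := largest_part_eq0 _ pb b0.
    rewrite /= in pa pb; case: H; have -> : j = 0%N by case: sz.
    rewrite -wL -rL pa pb.
    by rewrite col_rank_empty // weight_cons /weight big_nil.
  move: vL; rewrite valid2 => /and4P [_ y0 _ vy]; case/negP: y0; apply/eqP.
  by apply: largest_part_eq0; move: vy; case: (L) => [|z L']; rewrite ?valid2 valid1
    => /and4P [] // /and4P [].
rewrite (_ : symbols _ _ _ _ _ = [set [:: ([::], [::])]]).
  by rewrite fset_set1 cardfs1.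
apply/seteqP; split=> [[|[a b] [|y L]]|L ->] //.
- by case.
- case=> _; rewrite valid1 => /and4P [pa pb a0 b0] _ _.
  by move: (largest_part_eq0 _ pa a0) (largest_part_eq0 _ pb b0) => /= -> ->.
- by case.
- split=> //; first by rewrite weight_cons /weight big_nil.
  exact: col_rank_empty.
Qed.

Lemma size_leq_sumn (s : seq nat) : is_partition s -> (size s <= sumn s)%N.
Proof. by elim: s => //= x s IH; rewrite is_partition_cons => /and3P []; lia. Qed.

(** The rank is at most the number of parts in absolute value, hence at most the weight. This kills
    the boundary terms in [sum_sym_adjoint]. *)
Lemma nsym11_eq0 (D : nat) (m w : int) : w < `|m| -> nsym 1 1 D m w = 0.
Proof.
move=> wm; rewrite /nsym /count_set (_ : symbols _ _ _ _ _ = set0).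
  by rewrite fset_set0 cardfs0.
apply/seteqP; split=> // -[|[a b] [|y L]] [sz vL wL rL] //.
move: vL wL rL; rewrite valid1 weight_cons col_rank_cons //= /weight big_nil.
move=> /and4P [/= /size_leq_sumn sa /size_leq_sumn sb _ _] wL rL; lia.
Qed.

(** For several columns, exchanging upper and lower partitions need not respect the chain condition;
    but the recurrence and its initial values are invariant under [m -> - m]. *)
Lemma nsymN (i j D : nat) (m w : int) : (0 < i)%N ->
  nsym i j.+1 D (- m) w = nsym i j.+1 D m w.
Proof.
move=> i0.
apply: (@level_recurrence_uniq i (w + 1) (fun j D m w => nsym i j D (- m) w)
  (nsym i)); rewrite ?ltrDl //.
- move=> {}j {}D {}m w' wN; rewrite (nsym_rec i _ i0 _ _ _ _ wN).
  by congr (_ - _ + _ + _); rewrite opprB opprD addrC (addrC (i == _)%:Z).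
- exact: nsym_rec.
- by move=> *; rewrite !nsym_neg.
- by move=> *; rewrite !nsym0 // oppr_eq0.
Qed.

Lemma sum_symB (N : nat) (u v : int -> int) :
  sum_sym N (fun p => u p - v p) = sum_sym N u - sum_sym N v.
Proof. by rewrite /sum_sym sumrB. Qed.

Lemma sum_sym1 (N : nat) (u : int -> int) :
  (forall p, p != 0 -> u p = 0) -> sum_sym N u = u 0.
Proof.
move=> u0; rewrite /sum_sym (bigD1_seq N) ?iota_uniq //=; last first.
  by rewrite mem_index_iota; lia.
by rewrite subrr big1 ?addr0 // => q qN; apply: u0; lia.
Qed.

(** Both sides solve the same recurrence: on the right, [sum_sym_adjoint] carries the one-column
    recurrence over to the kernel, where [kernel_rec] applies. The factor 2 appears because the
    kernel comes from x^p + x^(-p) and the sum meets both [p] and [- p]. *)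
Lemma nsym_kernel (i j D N : nat) (m w : int) : (0 < i)%N -> w < N%:Z ->
  2 * nsym i j.+1 D m w =
  sum_sym N (fun p => kernel i j.+1 m p * nsym 1 1 D p w).
Proof.
move=> i0; apply: (@level_recurrence_uniq i N%:Z
  (fun j D m w => 2 * nsym i j D m w)
  (fun j D m w => sum_sym N (fun p => kernel i j m p * nsym 1 1 D p w))).
- move=> {}j {}D {}m {}w wN; rewrite (nsym_rec i _ i0 _ _ _ _ wN).
  by case: j => [|j]; ring.
- move=> {}j {}D {}m {}w wN; set K := kernel i j.+1.
  pose u p := nsym 1 1 D.+1 p (w - D.+1%:Z).
  pose v p := nsym 1 1 D.+1 p (w - D.+1%:Z - D.+1%:Z).
  pose z p := nsym 1 1 D p w.
  transitivity (sum_sym N (fun p => K m p * (u (p - 1) + u (p + 1))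
                                    - K m p * v p + K m p * z p)).
    apply: eq_sum_sym => p; rewrite (nsym_rec 1 _ _ _ _ _ _ wN) //=.
    by rewrite -/(u _) -/(u _) -/(v _) -/(z _); ring.
  rewrite sum_symD sum_symB sum_sym_adjoint; last first.
    by move=> p pN; apply: nsym11_eq0; lia.
  rewrite (eq_sum_sym _ _ (fun p => K (m - (i == j.+1)%:Z) p * u p
    + K (m + (i == j.+1)%:Z) p * u p
    + (if j is 0 then 0 else kernel i j m p) * u p)); last first.
    by move=> p; rewrite kernel_rec // !mulrDl.
  rewrite !sum_symD; case: j @K => [|j] K.
    rewrite (eq_sum_sym _ (fun p => 0 * u p) (fun=> 0)); last by move=> p; rewrite mul0r.
    by rewrite {3}/sum_sym big1_eq; ring.
  by rewrite -/(u _); ring.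
- move=> {}j {}D {}m {}w w0; rewrite nsym_neg // mulr0.
  rewrite /sum_sym big1 // => p _; by rewrite nsym_neg // mulr0.
- move=> {}j {}m {}w; rewrite sum_sym1 => [|p p0]; last first.
    by rewrite nsym0 // (negbTE p0) mulr0.
  by rewrite !nsym0 // kernel0 //; case: (j == 0)%N; case: (m == 0); case: (w == 0).
Qed.

(** Summing [nsym_kernel] over [m] leaves a binomial in [absz p], which is even and vanishes at 0.
    The symmetric sum is thus twice the sum over positive [p], and the factor 2 cancels. *)
Lemma sum_nsym (i k D N : nat) (w : int) : (0 < i <= k.+2)%N -> w < N%:Z ->
  \sum_(1 <= m < N.+1) nsym i k.+2 D m%:Z w =
  \sum_(1 <= p < N.+1) 'C(p + k, k.*2.+2)%:Z * nsym 1 1 D p%:Z w.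
Proof.
move=> /andP [i0 ik] wN; apply: (@mulfI _ (2 : int)) => //.
rewrite -(@sum_sym_even N (fun p => 'C(absz p + k, k.*2.+2)%:Z * nsym 1 1 D p w)).
- rewrite big_distrr /=.
  rewrite (eq_bigr (fun m : nat => sum_sym N
    (fun p => kernel i k.+2 m%:Z p * nsym 1 1 D p w))); last first.
    by move=> m _; exact: nsym_kernel.
  rewrite /sum_sym exchange_big /=; apply: eq_big_nat => q qN.
  by rewrite -big_distrl /= sum_kernel //; lia.
- by rewrite bin_small ?mul0r // add0n; lia.
- by move=> p; rewrite nsymN // abszN.
Qed.

(** * Durfee squares *)

Local Open Scope nat_scope.

Lemma sorted_geq_cons (x : nat) (s : seq nat) :
  sorted geq (x :: s) = all (geq x) s && sorted geq s.
Proof. by rewrite /= path_sortedE // => a b c /= ba ac; exact: leq_trans ac ba. Qed.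

Lemma sorted_geq_nth (s : seq nat) (i j : nat) : sorted geq s -> i <= j ->
  nth 0 s j <= nth 0 s i.
Proof.
elim: s i j => [|x s IH] i j; first by rewrite !nth_nil.
rewrite sorted_geq_cons => /andP [xs ss]; case: i j => [|i] [|j] //= ij; last exact: IH.
have [js|js] := ltnP j (size s); last by rewrite nth_default.
exact: (allP xs _ (mem_nth 0 js)).
Qed.

(** In a non-increasing list the entries above [i] form a prefix. *)
Lemma ltn_count_sorted (s : seq nat) (i j : nat) : sorted geq s ->
  (j < count (fun x => i < x) s) = (i < nth 0 s j).
Proof.
elim: s j => [|x s IH] j; first by rewrite nth_nil.
rewrite sorted_geq_cons /= => /andP [xs ss]; case: (ltnP i x) => ix.
  by case: j => [|j] /=; rewrite ?ix // add1n ltnS IH.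
have -> : count (fun y => i < y) s = 0.
  apply/eqP; rewrite -leqn0 leqNgt -has_count; apply/hasPn => y ys.
  by rewrite -leqNgt (leq_trans (allP xs _ ys)).
have ss' : sorted geq (x :: s) by rewrite sorted_geq_cons xs.
have := sorted_geq_nth (x :: s) 0 j ss' isT; rewrite /=; lia.
Qed.

(* The conjugate of [s], padded with zeros or truncated to length [N]. *)
Definition conjugate (N : nat) (s : seq nat) : seq nat :=
  mkseq (fun i => count (fun x => i < x) s) N.

Lemma size_conjugate (N : nat) (s : seq nat) : size (conjugate N s) = N.
Proof. exact: size_mkseq. Qed.

Lemma sorted_conjugate (N : nat) (s : seq nat) : sorted geq (conjugate N s).
Proof.
apply/(sortedP 0) => i; rewrite size_conjugate => iN /=.
rewrite !nth_mkseq //; last exact: ltnW.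
by apply: sub_count => x /=; exact: ltnW.
Qed.

Lemma count_lt_iota (a N : nat) : count (fun i => i < a) (iota 0 N) = minn a N.
Proof. by elim: N => [|N IH]; rewrite ?minn0 // -addn1 iotaD count_cat IH /=; lia. Qed.

Lemma conjugateK (N : nat) (s : seq nat) : sorted geq s ->
  largest_part s <= N -> conjugate (size s) (conjugate N s) = s.
Proof.
move=> ss sN; apply: (@eq_from_nth _ 0); first exact: size_conjugate.
move=> j; rewrite size_conjugate => js; rewrite nth_mkseq // count_map.
(* Entry [j] of the double conjugate counts the [i < N] below the part at [j], which is that part
   since no part exceeds [N]. *)
rewrite (@eq_count _ _ (fun i => i < nth 0 s j)).
  rewrite count_lt_iota; apply/minn_idPl; apply: leq_trans sN.
  by rewrite /largest_part -nth0; exact: sorted_geq_nth.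
by move=> i /=; rewrite ltn_count_sorted.
Qed.

Lemma sumn_conjugate (N : nat) (s : seq nat) : sorted geq s ->
  largest_part s <= N -> sumn (conjugate N s) = sumn s.
Proof.
elim: s => [|x s IH] /=; first by rewrite sumnE big_map big1.
rewrite -/(sorted geq (x :: s)) sorted_geq_cons => /andP [xs ss] xN.
rewrite -[in RHS]IH //; last first.
  by apply: leq_trans xN; case: (s) xs => //= y s' /andP [].
rewrite !sumnE !big_map big_split /=; congr (_ + _).
rewrite -[RHS](minn_idPl xN) -count_lt_iota -sum1_count [RHS]big_mkcond.
by apply: eq_bigr => i _; case: (i < x).
Qed.

(** Parts are indexed from 0, so the first [i] whose part is at most [i] is the side of the Durfee
    square. The search succeeds at [size s] at the latest, where [nth] returns 0. *)
Definition durfee_size (s : seq nat) : nat :=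
  find (fun i => nth 0 s i <= i) (iota 0 (size s).+1).

Lemma durfee_size_leq (s : seq nat) : durfee_size s <= size s.
Proof.
rewrite -ltnS -[X in _ < X](size_iota 0) -has_find; apply/hasP.
by exists (size s); rewrite ?mem_iota ?nth_default //=.
Qed.

Lemma durfee_sizeP (s : seq nat) (D : nat) : sorted geq s ->
  durfee_size s = D.+1 <-> D < nth 0 s D /\ nth 0 s D.+1 <= D.+1.
Proof.
move=> ss; set p := fun i => nth 0 s i <= i.
have dle := durfee_size_leq s.
have hp : has p (iota 0 (size s).+1) by rewrite has_find size_iota.
have := nth_find 0 hp; rewrite -/(durfee_size s) nth_iota // add0n /p => atd.
have ltd i : i < durfee_size s -> i < nth 0 s i.
  move=> id; have := before_find 0 id; rewrite nth_iota //; last lia.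
  by rewrite add0n /p; lia.
split=> [dD|[D1 D2]].
  by rewrite dD in atd; split=> //; apply: ltd; rewrite dD.
apply/eqP; rewrite eqn_leq; apply/andP; split; rewrite leqNgt; apply/negP.
  by move/ltd; lia.
rewrite ltnS => dD; have := sorted_geq_nth s _ _ ss dD; lia.
Qed.

Lemma sumn_map_addn (d : nat) (s : seq nat) :
  sumn (map (addn d) s) = size s * d + sumn s.
Proof. by elim: s => //= x s ->; rewrite mulSn; lia. Qed.

(** The piece to the right of the square is conjugated so that its length is the largest part of [s]
    minus [D]; the two copies of [D] then cancel in the rank. *)
Definition durfee_symbol (D : nat) (s : seq nat) : seq column :=
  let t := map (fun x => x - D) (take D s) in
  [:: (conjugate (largest_part t) t, drop D s)].

(** Conjugating to length [D] pads with zeros, so that all rows of the square are present. *)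
Definition durfee_partition (D : nat) (L : seq column) : seq nat :=
  let c := head ([::], [::]) L in map (addn D) (conjugate D c.1) ++ c.2.

Lemma durfee_partitionE (D : nat) (a b : seq nat) :
  durfee_partition D [:: (a, b)] = map (addn D) (conjugate D a) ++ b.
Proof. by []. Qed.

Lemma durfee_symbolK (D : nat) (s : seq nat) : is_partition s ->
  durfee_size s = D.+1 -> durfee_partition D.+1 (durfee_symbol D.+1 s) = s.
Proof.
move=> /andP [ss _] dD; have [Ds _] := (durfee_sizeP _ _ ss).1 dD.
have Dsz := durfee_size_leq s; rewrite dD in Dsz.
rewrite durfee_partitionE.
set t := map _ (take _ _); have st : size t = D.+1 by rewrite size_map size_takel.
have sort_t : sorted geq t.
  apply: (@homo_sorted _ _ _ geq); last exact: take_sorted ss.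
  by move=> x y /= xy; exact: leq_sub2r.
rewrite -[X in conjugate X (conjugate _ _)]st conjugateK // -[RHS](cat_take_drop D.+1 s).
congr (_ ++ _); rewrite -map_comp map_id_in // => x /=.
move=> /(nthP 0) [i]; rewrite size_takel // => iD <-; rewrite nth_take // subnKC //.
exact: leq_trans Ds (sorted_geq_nth s i D ss iD).
Qed.

Lemma durfee_symbol_in (D n : nat) (m : int) (s : seq nat) :
  partitions_of n s -> partition_rank s = m -> durfee_size s = D.+1 ->
  symbols 1 1 D.+1 m (n%:Z - (D.+1 ^ 2)%:Z)%R (durfee_symbol D.+1 s).
Proof.
move=> [ps sn] rs dD; have /andP [ss s0] := ps.
have [Ds Ds1] := (durfee_sizeP _ _ ss).1 dD.
have Dsz := durfee_size_leq s; rewrite dD in Dsz.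
rewrite /durfee_symbol; set t := map _ _.
have st : size t = D.+1 by rewrite size_map size_takel.
have sort_t : sorted geq t.
  apply: (@homo_sorted _ _ _ geq); last exact: take_sorted ss.
  by move=> x y /= xy; exact: leq_sub2r.
have geD i : i < D.+1 -> D.+1 <= nth 0 s i.
  by move=> iD; exact: leq_trans Ds (sorted_geq_nth s i D ss iD).
have lt : largest_part t = nth 0 s 0 - D.+1.
  by rewrite /largest_part -nth0 (nth_map 0) ?size_takel // nth_take.
have take_t : map (addn D.+1) t = take D.+1 s.
  rewrite -map_comp map_id_in // => x /=.
  by move=> /(nthP 0) [i]; rewrite size_takel // => iD <-;
    rewrite nth_take // subnKC // geD.
split=> //.
- rewrite valid1 /=; apply/and4P; split.
  + rewrite /is_partition sorted_conjugate; apply/negP => /(nthP 0) [j].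
    rewrite size_conjugate => jt; rewrite nth_mkseq // => cj0.
    by have := ltn_count_sorted t j 0 sort_t; rewrite cj0 nth0 jt.
  + rewrite /is_partition drop_sorted //=; apply/negP => /mem_drop.
    exact/negP.
  + by rewrite /largest_part /conjugate; case: (head 0 t) => //= l;
      rewrite -st count_size.
  + by rewrite /largest_part -nth0 nth_drop addn0.
- rewrite weight_cons /weight big_nil /= sumn_conjugate //.
  have := congr1 sumn (cat_take_drop D.+1 s); rewrite sumn_cat -take_t.
  by rewrite sumn_map_addn st sn mulnn; lia.
- rewrite col_rank_cons //= size_conjugate size_drop lt -rs /partition_rank.
  by have := geD 0 isT; rewrite nth0 -/(largest_part s); lia.
Qed.

Lemma durfee_partition_in (D n : nat) (m : int) (L : seq column) :
  symbols 1 1 D.+1 m (n%:Z - (D.+1 ^ 2)%:Z)%R L ->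
  let s := durfee_partition D.+1 L in
  [/\ partitions_of n s, partition_rank s = m, durfee_size s = D.+1
    & durfee_symbol D.+1 s = L].
Proof.
case: L => [|[a b] [|y L]] [] // _; rewrite valid1 weight_cons col_rank_cons //=.
rewrite /weight big_nil => /and4P [pa pb aD bD] wL rL.
rewrite durfee_partitionE; set t := conjugate D.+1 a.
have st : size (map (addn D.+1) t) = D.+1 by rewrite size_map size_conjugate.
have /andP [sa a0] := pa; have /andP [sb b0] := pb.
have ht : largest_part t = size a.
  rewrite /largest_part /t /conjugate /= (@eq_in_count _ _ predT) ?count_predT // => x xa.
  by rewrite lt0n; apply: contra a0 => /eqP <-.
have sort_s : sorted geq (map (addn D.+1) t ++ b).
  have tr : transitive geq by move=> x y z /= yx xz; exact: leq_trans xz yx.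
  rewrite sorted_pairwise // pairwise_cat -!sorted_pairwise // sb andbT.
  apply/andP; split; last first.
    apply: (@homo_sorted _ _ _ geq); last exact: sorted_conjugate.
    by move=> x y /= xy; rewrite leq_add2l.
  apply/allrelP => _ y /mapP [x _ ->] /(nthP 0) [j _ <-] /=.
  apply: leq_trans (leq_addr _ _); apply: leq_trans bD.
  by rewrite /largest_part -nth0; exact: sorted_geq_nth.
split.
- split; first rewrite /is_partition sort_s mem_cat negb_or b0 andbT.
    by apply/negP => /mapP [x _].
  rewrite sumn_cat sumn_map_addn sumn_conjugate // size_conjugate mulnn.
  by move: wL => /=; lia.
- rewrite /partition_rank /largest_part -nth0 nth_cat size_cat st ltn0Sn.
  rewrite (nth_map 0) ?size_conjugate // nth0 -/(largest_part t) ht.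
  by move: rL => /=; lia.
- apply/durfee_sizeP => //; rewrite !nth_cat st ltnn ltnSn subnn nth0; split=> //.
  by rewrite (nth_map 0) ?size_conjugate // addSn ltnS leq_addr.
- rewrite /durfee_symbol take_size_cat // drop_size_cat // -map_comp map_id_in.
    by rewrite ht conjugateK.
  by move=> x _ /=; rewrite addKn.
Qed.

(** * Sorting partitions and marked symbols by the side of the square *)

Lemma rank_count_durfee (n : nat) (m : int) : 0 < n ->
  Posz (rank_count m n) =
  (\sum_(1 <= D < n.+1) nsym 1 1 D m (n%:Z - (D ^ 2)%:Z))%R.
Proof.
move=> n0; rewrite /rank_count.
have fin : finite_set [set s | partitions_of n s /\ partition_rank s = m].
  by apply: sub_finite_set (finite_partitions n) => s [].
rewrite (@count_set_fibers _ _ durfee_size n fin).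
  rewrite -[LHS]natz natr_sum; apply: eq_big_nat => -[|D] // _.
  rewrite natz /nsym; congr Posz.
  apply: (@count_set_bij _ _ _ _ (durfee_symbol D.+1) (durfee_partition D.+1)).
  - by apply: finite_setI; left.
  - move=> s [[ps rs] dD]; split; first exact: durfee_symbol_in.
    by apply: durfee_symbolK => //; case: ps.
  - by move=> L /durfee_partition_in [ps rs dD KL].
move=> s [[ps sn] _]; apply/andP; split.
  case: s ps sn => [_ n00|x s ps _]; first by rewrite -n00 in n0.
  by move: ps; rewrite is_partition_cons /durfee_size /= leqn0 => /andP [x0 _];
    case: x x0.
by rewrite -sn; apply: leq_trans (durfee_size_leq s) (size_leq_sumn _ ps).
Qed.

Lemma durfee_rankE (k i : nat) (t : durfee_array k) : 1 <= i <= k ->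
  durfee_rank i t = col_rank i (rev t.1).
Proof.
move=> ik; rewrite /durfee_rank /col_rank size_rev size_tuple.
have -> : (k < i) = false by lia.
rewrite nth_rev ?size_tuple; last lia.
have -> : k - (k - i).+1 = i - 1 by lia.
by rewrite /alpha /beta; case: (i < k); rewrite ?subr0.
Qed.

Lemma col_rank_leq_weight (D i : nat) (L : seq column) :
  valid D L -> (col_rank i L <= (weight L)%:Z)%R.
Proof.
move=> /and4P [/allP pL _ _ _]; rewrite /col_rank; case: ltnP => // iL.
set c := nth _ _ _; case: (boolP (c \in L)) => [cL|].
  have /andP [/size_leq_sumn c1 _] := pL _ cL.
  have : sumn c.1 + sumn c.2 <= weight L.
    by rewrite /weight (big_rem c) //= leq_addr.
  lia.
move=> cL; have -> : c = ([::], [::]).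
  rewrite /c nth_default // leqNgt; apply: contra cL => h; exact: mem_nth.
by rewrite /=; lia.
Qed.

Lemma count_marked_durfee_rank (k n i : nat) : 1 <= i <= k ->
  Posz (count_set [set t : durfee_array k |
    marked_durfee n t /\ (0 < durfee_rank i t)%R]) =
  (\sum_(1 <= D < n.+1) \sum_(1 <= m < n.+1)
     nsym i k D m%:Z (n%:Z - (D ^ 2)%:Z))%R.
Proof.
move=> ik.
have fin : finite_set [set t : durfee_array k |
    marked_durfee n t /\ (0 < durfee_rank i t)%R].
  by apply: sub_finite_set (@finite_marked_durfee k n) => t [].
rewrite (@count_set_fibers _ _ (@side k) n fin); last first.
  move=> t [/marked_durfeeP [-> _ <-] _] /=.
  by apply: leq_trans (leq_addl _ _); rewrite -mulnn; nia.
rewrite -[LHS]natz natr_sum; apply: eq_big_nat => D /andP [D0 _]; rewrite natz.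
have finD : finite_set ([set t : durfee_array k |
    marked_durfee n t /\ (0 < durfee_rank i t)%R] `&` [set t | side t = D]).
  by apply: finite_setI; left.
(* The rank is positive here, so its absolute value loses nothing. *)
rewrite (@count_set_fibers _ _ (fun t => absz (durfee_rank i t)) n finD).
  rewrite -[LHS]natz natr_sum; apply: eq_big_nat => m /andP [m0 _].
  rewrite natz /nsym; congr Posz.
  pose f (t : durfee_array k) : seq column := rev t.1.
  (* The default tuple is reached only for lists whose size is not [k]. *)
  pose g (L : seq column) : durfee_array k :=
    (insubd (nseq_tuple k ([::], [::])) (rev L), D).
  apply: (@count_set_bij _ _ _ _ f g).
  - by apply: finite_setI; left.
  - move=> t [[[/marked_durfeeP [_ vt wt] rt] sD] rm]; split.
      split; rewrite ?size_rev ?size_tuple -?sD //; first by rewrite -wt PoszD addrK.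
      have rm' : absz (durfee_rank i t) = m := rm.
      by rewrite -rm' gtz0_abs //; symmetry; exact: durfee_rankE.
    case: t {vt wt rt rm} sD => s d /=; rewrite /side /f /g /= revK => ->.
    by rewrite valKd.
  - move=> L [sz vL wL rL].
    have gL : rev (g L).1 = L.
      by rewrite /g /= insubdK ?revK // unfold_in /= size_rev sz eqxx.
    split; last exact: gL.
    have rg : durfee_rank i (g L) = Posz m by rewrite durfee_rankE // gL.
    split; last by rewrite /= rg.
    split=> //; split; last by rewrite rg.
    by apply/marked_durfeeP; rewrite gL /side /=; split=> //; lia.
move=> t [[/marked_durfeeP [_ vt wt] rt] _].
have := col_rank_leq_weight _ i _ vt; rewrite -durfee_rankE //; lia.
Qed.

Lemma eta_barE (k n : nat) :
  eta_bar k n = \sum_(1 <= m < n.+1) 'C(m + k - 1, 2 * k) * rank_count m%:Z n.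
Proof.
rewrite /eta_bar (fsbigE (index_iota 1 n.+1)) ?iota_uniq //.
- rewrite [LHS]big_nat_cond [RHS]big_nat_cond; apply: eq_bigl => m.
  case: (boolP (1 <= m < n.+1)) => //= /andP [m1 _].
  by rewrite mem_set.
- by move=> m /=; rewrite mem_index_iota => /andP [].
- move=> m /= m1; rewrite mem_index_iota m1 /= ltnS -ltnNge => nm.
  by rewrite rank_count_eq0 // muln0.
Qed.

Theorem theorem2p2 (k i : nat) (hk : 0 < k) (hi : 1 <= i <= k + 1)
    (n : nat) (hn : 0 < n) :
  eta_bar k n =
  count_set [set t : durfee_array (k + 1) |
              marked_durfee n t /\ (0 < durfee_rank i t)%R].
Proof.
(* From here [k] is the predecessor of the original one, and the symbols have [k.+2] columns as in
   [sum_nsym]. *)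
case: k hk hi => // k _ hi; apply/eqP; rewrite -eqz_nat; apply/eqP.
rewrite count_marked_durfee_rank // eta_barE -[LHS]natz natr_sum addn1.
transitivity (\sum_(1 <= D < n.+1) \sum_(1 <= p < n.+1)
    'C(p + k, k.*2.+2)%:Z * nsym 1 1 D p%:Z (n%:Z - (D ^ 2)%:Z))%R.
  rewrite exchange_big /=; apply: eq_big_nat => m _.
  rewrite natz PoszM rank_count_durfee // big_distrr /=.
  by apply: eq_bigr => D _; congr (Posz 'C(_, _) * _)%R; lia.
(* The sides agree for each square separately; as its side is positive, the remaining weight is less
   than [n], the bound on the ranks. *)
apply: eq_big_nat => -[|D] // _; rewrite sum_nsym //; [lia|nia].
Qed.
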